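(* Let $h$ be an arithmetical function (defined on the positive integers, real-valued) for which there is $n_0$ such that $n\le h(n)\le \sigma(n)$ for every $n\ge n_0$. Then \[ \liminf_{n\to \infty} \frac{h(\sigma(n))}{n} =1. \]
   Context: $\sigma(n)$ is the sum of the positive divisors of $n$. *)

(* Defs.v *)
From HB Require Import structures.
From mathcomp Require Import all_boot all_order all_algebra.
From mathcomp Require Import all_classical all_reals all_analysis.
Set Implicit Arguments.
Unset Strict Implicit.
Unset Printing Implicit Defensive.

                                                                           
Definition sigma (n : nat) : nat := \sum_(d <- divisors n) d.

(* Main.v *)
Require Import Defs.
From HB Require Import structures.
From mathcomp Require Import all_boot all_order all_algebra all_solvable.
From mathcomp Require Import all_classical all_reals all_analysis.
From mathcomp Require Import zify lra.
Set Implicit Arguments.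
Unset Strict Implicit.
Unset Printing Implicit Defensive.
Import Order.TTheory GRing.Theory Num.Theory.

(* Since sigma n >= n, every term is eventually at least 1, so it is enough to
   make sigma (sigma n) / n close to 1 for arbitrarily large n.  Take
   n = p ^ (q - 1) with p, q prime, p large and q >= p ^ p.  Then
   N = sigma n = (p ^ q - 1) / (p - 1) is at most n p / (p - 1), and all prime
   factors of N exceed q: modulo a prime r <= q dividing N, the order of p
   divides both q and r - 1, so p = 1 and N = q mod r, forcing r = q | p - 1.
   Hence N has K <= log_q N < q / p distinct prime factors and
   sigma N / N <= (1 + 1/q) ^ K <= (1 - K / (q + 1)) ^-1 <= p / (p - 1). *)

(* d |-> (gcd(d, a), d / gcd(d, a)) embeds the divisors of a * b into pairs of
   divisors of a and of b. *)
Lemma sigma_mul_le (a b : nat) : 0 < a -> 0 < b ->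
  sigma (a * b) <= sigma a * sigma b.
Proof.
move=> a0 b0; have ab0 : 0 < a * b by rewrite muln_gt0 a0.
rewrite /sigma big_distrl /=.
under [leqRHS]eq_bigr do rewrite big_distrr /=.
rewrite -(big_allpairs (F := fun z => z.1 * z.2)) /=.
pose f d := (gcdn d a, d %/ gcdn d a).
have fK d : (f d).1 * (f d).2 = d by rewrite mulnC divnK // dvdn_gcdl.
rewrite (eq_bigr (fun d => (f d).1 * (f d).2)) => [|d _]; last by rewrite fK.
rewrite -(big_map f predT (fun z => z.1 * z.2)).
apply: (@uniq_sub_le_big nat addn leq leqnn (fun x y => leq_addr y x)).
- by rewrite map_inj_uniq ?divisors_uniq // => c d /(congr1 (fun z => z.1 * z.2)); rewrite !fK.
- by apply: allpairs_uniq; rewrite ?divisors_uniq // => -[? ?] [? ?].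
move=> _ /mapP[d + ->]; rewrite -dvdn_divisors // => dab.
apply: allpairs_f; rewrite -dvdn_divisors //; first exact: dvdn_gcdr.
have g0 : 0 < gcdn d a by rewrite gcdn_gt0 a0 orbT.
(* The cofactor divides [b] because [d] divides both [d * b] and [a * b], hence [gcdn d a * b]. *)
rewrite -(@dvdn_pmul2l (gcdn d a)) // -[X in X %| _]/((f d).1 * (f d).2) fK.
by rewrite muln_gcdl dvdn_gcd dab dvdn_mulr.
Qed.

Lemma sigma_pfactor (p e : nat) : prime p -> sigma (p ^ e) = \sum_(i < e.+1) p ^ i.
Proof.
move=> pp; rewrite -(big_mkord predT (fun i => p ^ i)) -(big_map (expn p) predT id).
apply/perm_big/uniq_perm; first exact: divisors_uniq.
  by rewrite map_inj_uniq ?iota_uniq // => i j /eqP; rewrite eqn_exp2l ?prime_gt1 // => /eqP.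
move=> d; rewrite -dvdn_divisors ?expn_gt0 ?prime_gt0 //.
apply/dvdn_pfactor/mapP => // -[i]; rewrite ?mem_index_iota => ile ->.
  by exists i; rewrite ?mem_index_iota.
by exists i.
Qed.

Lemma sigma_pfactor_mul (p e : nat) : prime p ->
  p.-1 * sigma (p ^ e) = (p ^ e.+1).-1.
Proof. by move=> pp; rewrite sigma_pfactor // predn_exp. Qed.

Lemma sigma_ge (n : nat) : 0 < n -> n <= sigma n.
Proof.
move=> n0; rewrite /sigma (big_rem n) -?dvdn_divisors //=; exact: leq_addr.
Qed.

(** Each prime power [r ^ e] of [N] contributes a ratio below [r / (r - 1) <= (q + 1) / q], and a
    factor at least [q] to [N]. *)
Lemma sigma_large_primes (q N : nat) : 0 < N ->
    (forall r, prime r -> r %| N -> q < r) ->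
  sigma N * q ^ size (prime_decomp N) <= N * q.+1 ^ size (prime_decomp N) /\
  q ^ size (prime_decomp N) <= N.
Proof.
move=> N0 hN; have: {in prime_decomp N, forall f, [/\ prime f.1, q < f.1 & 0 < f.2]}.
  move=> [r e] /mem_prime_decomp [pr e0 rN]; split=> //=.
  exact: hN pr (dvdn_trans (dvdn_exp e0 (dvdnn r)) rN).
(* [N] is kept inside [prime_decomp N], so the induction runs over an arbitrary list of pairs. *)
rewrite {2 4 7}(prod_prime_decomp N0) {N0 hN}.
elim: (prime_decomp N) => [|[r e] s IH] hs.
  by rewrite !big_nil /sigma (_ : divisors 1 = [:: 1]) // big_seq1.
have /IH[IHs IHq] : {in s, forall f, [/\ prime f.1, q < f.1 & 0 < f.2]}.
  by move=> f fs; apply: hs; rewrite inE fs orbT.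
have /= [pr qr e0] := hs (r, e) (mem_head _ _).
have P0 : 0 < \prod_(f <- s) f.1 ^ f.2.
  rewrite big_seq prodn_cond_gt0 // => f fs.
  have [pf _ _] := hs f (@mem_behead _ ((r, e) :: s) f fs).
  by rewrite expn_gt0 prime_gt0.
rewrite big_cons /= !expnS.
have re0 : 0 < r ^ e by rewrite expn_gt0 prime_gt0.
have sr : sigma (r ^ e) * q <= r ^ e * q.+1.
  have := sigma_pfactor_mul e pr; rewrite expnS.
  have := sigma_ge re0; move: (r ^ e) (sigma _) re0 => E S; nia.
split.
  apply: (@leq_trans (sigma (r ^ e) * sigma (\prod_(j <- s) j.1 ^ j.2) * (q * q ^ size s))).
    by rewrite leq_mul2r sigma_mul_le ?orbT.
  by rewrite mulnACA [leqRHS]mulnACA leq_mul.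
rewrite leq_mul // (leq_trans (ltnW qr)) //.
by rewrite -[leqLHS]expn1 leq_exp2l // prime_gt1.
Qed.

Lemma prime_dvd_repunit (p q r : nat) : prime p -> prime q -> p < q ->
  prime r -> r %| \sum_(i < q) p ^ i -> q < r.
Proof.
move=> pp pq ltpq pr rN; rewrite ltnNge; apply/negP => rq.
have pq1 : p ^ q = 1 %[mod r].
  have p0 : 0 < p ^ q by rewrite expn_gt0 prime_gt0.
  apply/eqP; rewrite eqn_mod_dvd // subn1 predn_exp; exact: dvdn_mull.
have cpr : coprime p r.
  rewrite coprime_sym prime_coprime //; apply/negP => rp.
  have : r %| p ^ q by rewrite (dvdn_exp (prime_gt0 pq)).
  rewrite /dvdn pq1 modn_small ?prime_gt1 //.
have pr1 : p ^ r.-1 = 1 %[mod r].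
  by rewrite -(totient_prime pr) Euler_exp_totient.
have r1 := prime_gt1 pr.
have cqr : coprime q r.-1.
  rewrite prime_coprime //; apply/negP => /dvdn_leq; lia.
(* By Bézout [u * q = v * r.-1 + 1], so [p ^ (u * q)] is both [1] and [p] modulo [r]. *)
have p1 : p = 1 %[mod r].
  have [u v Euv _] := egcdnP r.-1 (prime_gt0 pq).
  rewrite (eqP cqr) in Euv.
  have : p ^ (u * q) = p ^ (v * r.-1 + 1) by rewrite Euv.
  move/(congr1 (modn^~ r)).
  rewrite mulnC expnM -modnXm pq1 modnXm exp1n expnD expn1.
  by rewrite mulnC (mulnC v) expnM -modnMmr -modnXm pr1 modnXm exp1n modnMmr muln1.
have sq : \sum_(i < q) p ^ i = q %[mod r].
  rewrite -modn_summ.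
  under eq_bigr do rewrite -modnXm p1 modnXm exp1n.
  by rewrite modn_summ sum1_card card_ord.
have rq' : r = q.
  by apply/eqP; rewrite -(dvdn_prime2 pr pq) /dvdn -sq.
have : r %| p - 1 by rewrite -eqn_mod_dvd ?prime_gt0 // p1.
move/dvdn_leq; have := prime_gt1 pp; lia.
Qed.

(** Bernoulli's inequality for [(1 - 1 / (q + 1)) ^ k], cleared of denominators; truncated
    subtraction makes large [k] trivial. *)
Lemma bernoulli_nat (q k : nat) : q.+1 ^ k * (q.+1 - k) <= q ^ k * q.+1.
Proof.
elim: k => [|k IH]; first by rewrite !expn0 subn0.
rewrite !expnS; have : q.+1 * (q.+1 - k.+1) <= q * (q.+1 - k) by nia.
move: IH; move: (q.+1 ^ k) (q ^ k) => A B; nia.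
Qed.

Lemma sigma_sigma_pfactor (p q : nat) : prime p -> prime q -> p ^ p <= q ->
  sigma (sigma (p ^ q.-1)) * p.-1 ^ 2 <= p ^ q.-1 * p ^ 2.
Proof.
move=> pp pq ppq.
have p1 := prime_gt1 pp; have q1 := prime_gt1 pq.
have ltpq : p < q by apply: leq_trans ppq; exact: ltn_expl.
rewrite [in sigma (sigma _)]sigma_pfactor // prednK ?prime_gt0 //.
set N := \sum_(i < q) p ^ i.
have EN : (p ^ q).-1 = p.-1 * N by rewrite predn_exp.
have pq0 : 0 < p ^ q by rewrite expn_gt0 prime_gt0.
have pqS : p ^ q = p * p ^ q.-1 by rewrite -expnS prednK // prime_gt0.
have N0 : 0 < N by have := ltn_expl q p1; nia.
have [] := sigma_large_primes N0 (fun r => @prime_dvd_repunit p q r pp pq ltpq).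
set K := size _ => sN qN.
(* From [p ^ p <= q]: [p ^ (p * K) <= q ^ K <= N < p ^ q]. *)
have pK : p * K < q.
  rewrite -(ltn_exp2l _ _ p1) expnM; apply: (@leq_ltn_trans N); last nia.
  by apply: leq_trans qN; case: (K) => // k; rewrite leq_exp2r.
have SN : sigma N * p.-1 <= N * p.
  have sB : sigma N * (q.+1 - K) <= N * q.+1.
    rewrite -(@leq_pmul2l (q.+1 ^ K)) ?expn_gt0 //.
    have := bernoulli_nat q K; nia.
  (* [p * K < q] gives [q.+1 * p.-1 <= (q.+1 - K) * p]. *)
  nia.
nia.
Qed.

Local Open Scope ring_scope.

(** The infimum of the tail from [m] is at most [l + e] for every [m], and at least [l] once
    [m >= n0]. *)
Lemma limn_einf_eq (R : realType) (u : nat -> R) (l : R) :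
    (exists n0, forall n, (n0 <= n)%N -> l <= u n) ->
    (forall e, 0 < e -> forall n0, exists2 n, (n0 <= n)%N & u n <= l + e) ->
  limn_einf (fun n => (u n)%:E) = l%:E.
Proof.
move=> [n0 lb] ub; rewrite limn_einf_lim; apply/eqP; rewrite eq_le; apply/andP; split.
  apply/lee_addgt0Pr => e e0; apply: lime_le; first exact: is_cvg_einfs.
  near=> m; have [n mn un] := ub e e0 m.
  apply: (@le_trans _ _ (u n)%:E); last by rewrite -EFinD lee_fin.
  by apply: ereal_inf_lbound; exists n.
apply: lime_ge; first exact: is_cvg_einfs.
exists n0 => // m /= n0m; apply: le_ereal_inf_tmp => _ [n /= mn <-].
by rewrite lee_fin lb // (leq_trans n0m).
Unshelve. all: by end_near. Qed.

Lemma sigma_sigma_le (R : realType) (e : R) (n0 : nat) : 0 < e ->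
  exists2 n, (0 < n)%N && (n0 <= n)%N & (sigma (sigma n))%:R / n%:R <= 1 + e.
Proof.
(* With [x = p - 1 >= 1], [(1 + 1 / x) ^ 2 <= 1 + 3 / x], which is below [1 + e] once
   [x > 3 / e]. *)
move=> e0; pose a : R := 3 / e.
have [p + pp] := prime_above (Num.truncn a).+1.
have := truncnS_gt a => ha hp.
have [q + pq] := prime_above (maxn n0 (p ^ p)).
rewrite gtn_max => /andP[n0q ppq].
have p0 := prime_gt0 pp.
have n1 : (0 < p ^ q.-1)%N by rewrite expn_gt0 p0.
exists (p ^ q.-1)%N.
  rewrite n1 /=; have := ltn_expl q.-1 (prime_gt1 pp); lia.
rewrite ler_pdivrMr ?ltr0n //.
have := sigma_sigma_pfactor pp pq (ltnW ppq).
move: (p ^ q.-1)%N n1 => n n1.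
rewrite -!mulnn -(ler_nat R) !natrM -!expr2.
have : 3 / e < p.-1%:R :> R by apply: lt_le_trans ha _; by rewrite ler_nat -ltnS prednK.
rewrite ltr_pdivrMr // -[in p%:R](prednK p0) -[p.-1.+1%:R]natr1.
have : 1 <= p.-1%:R :> R by rewrite ler1n; lia.
move: (p.-1%:R) => x x1 xe H.
have x0 : 0 < x ^+ 2 by nra.
rewrite -(ler_pM2r x0); apply: le_trans H _.
rewrite [leRHS]mulrAC (mulrC _ n%:R) ler_wpM2l ?ler0n //.
have : 0 <= x * (x * e - 3) by apply: mulr_ge0; lra.
rewrite !expr2; lra.
Qed.

(* MathComp-Analysis.  [h] is an arithmetical function: its value at 0 is
   irrelevant (no hypothesis constrains it, and the term of index 0 does not
   affect the lower limit). *)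
Theorem theorem5 (R : realType) (h : nat -> R)
    (hh : exists n0 : nat, forall n : nat, (0 < n)%N -> (n0 <= n)%N ->
        n%:R <= h n /\ h n <= (sigma n)%:R) :
  limn_einf (fun n : nat => (h (sigma n) / n%:R)%:E) = 1%:E.
Proof.
have [n0 {}hh] := hh.
have hs n : (0 < n)%N -> (n0 <= n)%N ->
    (sigma n)%:R <= h (sigma n) /\ h (sigma n) <= (sigma (sigma n))%:R.
  move=> n1 n0n; have := sigma_ge n1 => sn.
  by apply: hh; [exact: leq_trans n1 sn|exact: leq_trans n0n sn].
apply: limn_einf_eq => [|e e0 m].
  exists (maxn 1 n0) => n; rewrite geq_max => /andP[n1 n0n].
  rewrite ler_pdivlMr ?ltr0n // mul1r (le_trans _ (hs n n1 n0n).1) //.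
  by rewrite ler_nat sigma_ge.
have [n /andP[n1]] := sigma_sigma_le (maxn n0 m) e0.
rewrite geq_max => /andP[n0n mn] sn; exists n => //.
by apply: le_trans sn; rewrite ler_wpM2r ?invr_ge0 // (hs n n1 n0n).2.
Qed.
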